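(* If $\psi\in\mathcal{D}_1$, then both $$\sum_{k=1}^n\psi'(k)\sim\psi(n)\quad\text{and}\quad \psi(n+1)\sim\psi(n),\qquad n\to\infty,$$ hold. If $\psi\in\mathcal{D}_2$, then $$\sum_{k=1}^n\psi'(k)\sim\psi(n),\qquad n\to\infty,$$ holds.
   Context: $\mathcal{D}$ denotes the class of strictly increasing, differentiable, unbounded functions $\psi:(0,\infty)\to(0,\infty)$. $\mathcal{D}_1$ is the class of all concave functions in $\mathcal{D}$. $\mathcal{D}_2$ is the class of all convex functions $\psi\in\mathcal{D}$ that satisfy $\psi(n+1)\sim\psi(n)$ as $n\to\infty$ through the positive integers. Here $f(n)\sim g(n)$ means $f(n)/g(n)\to1$. *)

(* Defs.v *)
From mathcomp Require Import all_boot all_order all_algebra.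
From mathcomp Require Import all_classical all_reals all_analysis.

Set Implicit Arguments.
Unset Strict Implicit.
Unset Printing Implicit Defensive.

Import Order.TTheory GRing.Theory Num.Theory.
Import numFieldNormedType.Exports.

Local Open Scope classical_set_scope.
Local Open Scope ring_scope.

(* A function (0, oo) -> (0, oo) is a total function on R
   of which only the values on ]0, +oo[ are constrained; as ]0, +oo[ is open,
   derivatives at its points do not depend on the values elsewhere. *)

Record classD (R : realType) (psi : R -> R) : Prop := ClassD {
  classD_gt0 : forall x, 0 < x -> 0 < psi x ;
  classD_incr : {in `]0, +oo[ &, {homo psi : x y / x < y}} ;
  classD_derivable : forall x, 0 < x -> derivable psi x 1 ;
  classD_unbounded : ~ [bounded psi x | x in `]0, +oo[%classic] }.

Definition asymp (R : realType) (f g : nat -> R) : Prop :=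
  f n / g n @[n --> \oo] --> (1 : R).

Definition classD1 (R : realType) (psi : R -> R) : Prop :=
  classD psi /\
  convex_function (E := R^o) `]0, +oo[%classic (fun x : R => - psi x).

Definition classD2 (R : realType) (psi : R -> R) : Prop :=
  [/\ classD psi,
      convex_function (E := R^o) `]0, +oo[%classic psi
    & asymp (fun n => psi n.+1%:R) (fun n => psi n%:R)].

(* Main.v *)
Require Import Defs.
From mathcomp Require Import all_boot all_order all_algebra.
From mathcomp Require Import all_classical all_reals all_analysis.
From mathcomp Require Import ring lra.
Import Order.TTheory GRing.Theory Num.Theory.
Import numFieldNormedType.Exports.
Local Open Scope classical_set_scope.
Local Open Scope ring_scope.

(** The sum of the derivatives is compared with psi by telescoping.  A convex
function lies above its tangents, so its derivative at k is at most the
increment f(k+1) - f(k), and its derivative at k+1 is at least that increment.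
Summing over k traps the sum up to n between f(n) + O(1) and f(n+1) + O(1)
(convex_sum_derive_bounds); for concave psi the same bounds, applied to - psi,
hold with the two ends exchanged.

An increasing unbounded psi tends to infinity, so that additive constants do
not matter after division by psi(n) (asymp_squeeze).  For convex psi the two
ends are equivalent to psi(n) because psi(n+1) ~ psi(n) is part of the
hypothesis.  For concave psi this equivalence comes out of the bounds
themselves: the lower end psi(n+1) - psi(1) is at most the upper end
psi(n) - psi(1) + psi'(1), hence psi(n) <= psi(n+1) <= psi(n) + psi'(1). *)

(** The chord inequality at x + t (y - x) says that the difference quotient of
f at x in the direction y - x is at most f y - f x for every t in ]0, 1]; as t
tends to 0 from the right, the quotient tends to the directional derivative.
Working with directions treats y < x and x < y at once. *)
Lemma convex_tangent_le (R : realType) (D : set R) (f : R -> R) (x y : R) :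
  convex_function (E := R^o) D f -> D x -> D y -> derivable f x 1 ->
  f^`()%classic x * (y - x) <= f y - f x.
Proof.
move=> cf Dx Dy /derivable1_diffP df.
have -> : f^`()%classic x * (y - x) = 'D_(y - x) f x.
  rewrite derive1E !deriveE// -[in RHS](mulr1 (y - x)).
  by rewrite -[(y - x) * 1]/((y - x) *: (1 : R^o)) linearZ /= mulrC.
have := diff_derivable (v := y - x) df; rewrite /derivable.
move=> /cvg_dnbhs_at_right cvgq.
apply: (cvgr_to_le cvgq); near=> t.
have t0 : 0 < t by near: t; exact: nbhs_right_gt.
have t1 : t <= 1 by near: t; exact: nbhs_right_le.
have := cf (Itv01 (ltW t0) t1) y x; rewrite !inE => /(_ Dy Dx).
rewrite !convRE /= /unstable.onem => le_chord.
have -> : t *: (y - x) + x = t * y + (1 - t) * x.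
  by rewrite /GRing.scale /=; ring.
rewrite /GRing.scale /= mulrC ler_pdivrMr//; lra.
Unshelve. all: by end_near. Qed.

(** In the lower bound the term of index 1 is kept apart, and each term of index
k + 2 is compared with the increment of f that ends there; in the upper bound
each term is compared with the increment that starts there. *)
Lemma convex_sum_derive_bounds (R : realType) (f : R -> R) (n : nat) :
  convex_function (E := R^o) `]0, +oo[%classic f ->
  (forall x, 0 < x -> derivable f x 1) ->
  f n.+1%:R - f 1 + f^`()%classic 1 <=
    \sum_(1 <= k < n.+2) f^`()%classic k%:R <= f n.+2%:R - f 1.
Proof.
move=> cf df.
have tangent k m : f^`()%classic k.+1%:R * (m.+1%:R - k.+1%:R) <=
    f m.+1%:R - f k.+1%:R.
  by apply: convex_tangent_le cf _ _ (df _ _) => //=;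
    rewrite ?in_itv/= ?andbT ltr0Sn.
apply/andP; split.
  rewrite big_nat_recl// -[f 1]/(f 1%:R) -(telescope_sumr (fun k => f k%:R))//.
  rewrite addrC lerD2l; apply: ler_sum_nat => -[//|k] _.
  have := tangent k.+1 k; rewrite -(natr1 k.+1); lra.
rewrite -[f 1]/(f 1%:R) -(telescope_sumr (fun k => f k%:R))//.
apply: ler_sum_nat => -[//|k] _.
have := tangent k k.+1; rewrite -(natr1 k.+1); lra.
Qed.

(** If psi did not tend to infinity along the integers, some A would exceed
psi n for arbitrarily large n, hence by monotonicity bound psi everywhere on
]0, +oo[; positivity of psi gives the bound from below. *)
Lemma classD_cvgy (R : realType) (psi : R -> R) :
  classD psi -> psi n%:R @[n --> \oo] --> +oo.
Proof.
move=> [psi_gt0 psi_incr _ psi_unbounded]; apply/cvgryPge => A.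
apply: contrapT => not_near; apply: psi_unbounded.
exists A; split; first exact: num_real.
move=> M AM x /=; rewrite in_itv/= andbT => x0.
rewrite gtr0_norm ?psi_gt0//; apply: le_trans (ltW AM).
rewrite leNgt; apply/negP => Ax; apply: not_near.
near=> n; apply: (le_trans (ltW Ax)); apply/ltW/psi_incr.
- by rewrite in_itv/= x0.
- rewrite in_itv/= andbT; apply: (lt_trans x0).
  by near: n; exact: nbhs_infty_gtr.
- by near: n; exact: nbhs_infty_gtr.
Unshelve. all: by end_near. Qed.

(** Divergence of f serves here to make f n nonzero eventually: the quotient
0 / 0 is 0, so reflexivity fails for a sequence that vanishes infinitely
often. *)
Lemma asymp_refl (R : realType) (f : nat -> R) :
  f n @[n --> \oo] --> +oo -> asymp f f.
Proof.
move=> /cvgryPgt fy.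
apply: (@cvg_trans _ ((1 : R) @[n --> \oo])); last exact: cvg_cst.
apply: near_eq_cvg; near=> n; rewrite divff// gt_eqF//.
by near: n; exact: fy.
Unshelve. all: by end_near. Qed.

(** The constants a and b vanish after division by f n, which tends to
infinity. *)
Lemma asymp_squeeze (R : realType) (f g h u : nat -> R) (a b : R) :
  f n @[n --> \oo] --> +oo -> asymp g f -> asymp h f ->
  (\forall n \near \oo, g n + a <= u n <= h n + b) -> asymp u f.
Proof.
move=> fy gf hf gauhb.
have f_gt0 : \forall n \near \oo, 0 < f n by move/cvgryPgt: fy; exact.
have finv0 : (f n)^-1 @[n --> \oo] --> (0 : R) by exact/gtr0_cvgV0.
have shift v c : asymp v f -> (v n + c) / f n @[n --> \oo] --> (1 : R).
  move=> vf; rewrite -[1 in X in _ --> X]addr0 -[0 in X in _ --> X](mulr0 c).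
  under eq_fun do rewrite mulrDl.
  by apply: cvgD => //; apply: cvgM => //; exact: cvg_cst.
apply: squeeze_cvgr (shift _ a gf) (shift _ b hf); near=> n.
have fn0 : 0 < f n by near: n.
by rewrite !ler_pM2r ?invr_gt0//; near: n.
Unshelve. all: by end_near. Qed.

Theorem lemma2p2 (R : realType) (psi : R -> R) :
  (classD1 psi ->
     asymp (fun n => \sum_(1 <= k < n.+1) psi^`()%classic k%:R) (fun n => psi n%:R) /\
     asymp (fun n => psi n.+1%:R) (fun n => psi n%:R)) /\
  (classD2 psi ->
     asymp (fun n => \sum_(1 <= k < n.+1) psi^`()%classic k%:R) (fun n => psi n%:R)).
Proof.
split=> [[Dpsi cpsi]|[Dpsi cpsi psiS]];
  have psiy := classD_cvgy _ _ Dpsi;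
  have psi_derivable := classD_derivable Dpsi.
- have bounds n : psi n.+2%:R - psi 1 <=
      \sum_(1 <= k < n.+2) psi^`()%classic k%:R <=
      psi n.+1%:R - psi 1 + psi^`()%classic 1.
    have dN x : 0 < x -> (- psi)^`()%classic x = - psi^`()%classic x.
      by move=> x0; rewrite !derive1E deriveN//; exact: psi_derivable.
    have := convex_sum_derive_bounds R _ n cpsi
      (fun x x0 => derivableN (psi_derivable x x0)).
    rewrite [X in _ <= X <= _](_ : _ =
      - \sum_(1 <= k < n.+2) psi^`()%classic k%:R); last first.
      by rewrite -sumrN; apply: eq_big_nat => -[//|k] _; rewrite dN// ltr0Sn.
    rewrite dN// => /andP[lo hi]; apply/andP; split; lra.
  have psi_leS n : psi n.+1%:R <= psi n.+2%:R.
    by apply/ltW/(classD_incr Dpsi); rewrite ?in_itv/= ?ltr0Sn// ltr_nat.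
  split.
  + apply: (asymp_squeeze R _ _ _ _ (- psi 1) (psi^`()%classic 1 - psi 1) psiy
      (asymp_refl _ _ psiy) (asymp_refl _ _ psiy)).
    exists 1%N => // -[//|n] _ /=; have := bounds n; have := psi_leS n; lra.
  (* Combining the two ends of bounds eliminates the sum. *)
  + apply: (asymp_squeeze R _ _ _ _ 0 (psi^`()%classic 1) psiy
      (asymp_refl _ _ psiy) (asymp_refl _ _ psiy)).
    exists 1%N => // -[//|n] _ /=; have := bounds n; have := psi_leS n; lra.
- apply: (asymp_squeeze R _ _ _ _ (psi^`()%classic 1 - psi 1) (- psi 1) psiy
    (asymp_refl _ _ psiy) psiS).
  exists 1%N => // -[//|n] _ /=.
  have := convex_sum_derive_bounds R _ n cpsi psi_derivable; lra.
Qed.
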